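(* Let $W_n$ be the irreducible Coxeter group of type $\mathrm{A}_n$, $\mathrm{B}_n$ or $\mathrm{D}_n$ (each of the three families considered separately). Then the fourth centred moment $\mathbb{E}\big((T_{W_n}-\mathbb{E}(T_{W_n}))^4\big)$ is of order $n^2$, i.e. there are constants $0<c\le C$ such that $c n^2\le \mathbb{E}\big((T_{W_n}-\mathbb{E}(T_{W_n}))^4\big)\le Cn^2$ for all sufficiently large $n$.
   Context: For a finite Coxeter system $(W,S)$, $\operatorname{des}(w)=|\{s\in S: l_S(ws)<l_S(w)\}|$ where $l_S$ is word length, $t(w)=\operatorname{des}(w)+\operatorname{des}(w^{-1})$, and $T_W$ is the random variable $t(w)$ for $w$ uniform in $W$. $\mathrm{A}_n\cong \operatorname{Sym}(n+1)$, $\mathrm{B}_n$ is the hyperoctahedral group of signed permutations of rank $n$, $\mathrm{D}_n$ its index-two subgroup of signed permutations with an even number of negative entries, each with its standard Coxeter generators. *)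

(* Defs.v *)
From HB Require Import structures.
From mathcomp Require Import all_boot all_order all_algebra all_fingroup.
Set Implicit Arguments. Unset Strict Implicit. Unset Printing Implicit Defensive.
Import Order.TTheory GRing.Theory Num.Theory.

Section CoxStat.
Variable gT : finGroupType.
Variable S : {set gT}.

Definition powS (k : nat) : {set gT} := iter k (fun A => (A * S)%g) [set 1%g].

(* word length l_S(w): least k such that w is a product of k generators
   (search bounded by #|gT|, which suffices for every w in <<S>>). *)
Definition wlen (w : gT) : nat := find (fun k => w \in powS k) (iota 0 #|gT|.+1).

Definition des (w : gT) : nat := #|[set s in S | wlen (w * s)%g < wlen w]|.

Definition tstat (w : gT) : nat := des w + des (w^-1)%g.

Definition meanT : rat :=
  (\sum_(w in <<S>>%g) ((tstat w)%:R : rat)) / (#|<<S>>%g|)%:R.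

Definition m4T : rat :=
  (\sum_(w in <<S>>%g) (((tstat w)%:R : rat) - meanT) ^+ 4) / (#|<<S>>%g|)%:R.
End CoxStat.

Definition coxA (n : nat) : {set {perm 'I_n.+1}} :=
  [set tperm i j | i in [set: 'I_n.+1], j in [set: 'I_n.+1] & val j == (val i).+1].

(* Signed permutations of rank n are realized as the permutations of 'I_n * bool
   (the point (i, b) stands for the signed letter +/-(i+1), b = true meaning negative)
   commuting with the sign flip; <<coxB n>> is the hyperoctahedral group B_n. *)
Definition adjB (n : nat) : {set {perm 'I_n * bool}} :=
  [set (tperm (i, false) (j, false) * tperm (i, true) (j, true))%g
     | i in [set: 'I_n], j in [set: 'I_n] & val j == (val i).+1].

Definition coxB (n : nat) : {set {perm 'I_n * bool}} :=
  [set tperm (i, false) (i, true) | i in [set i : 'I_n | val i == 0]] :|: adjB n.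

Definition coxD (n : nat) : {set {perm 'I_n * bool}} :=
  [set (tperm (i, false) (j, true) * tperm (i, true) (j, false))%g
     | i in [set: 'I_n], j in [set: 'I_n] & (val i == 0) && (val j == 1)] :|: adjB n.

Definition order_n2 (f : nat -> rat) : Prop :=
  exists c C : rat, (0 < c)%R /\ (c <= C)%R /\
    exists N : nat, forall n : nat, (N <= n)%N ->
      (c * (n%:R) ^+ 2 <= f n)%R /\ (f n <= C * (n%:R) ^+ 2)%R.

(* Main.v *)
Require Import Defs.
From HB Require Import structures.
From mathcomp Require Import all_boot all_order all_algebra all_fingroup.
From mathcomp Require Import ring lra zify.
Set Implicit Arguments. Unset Strict Implicit. Unset Printing Implicit Defensive.
Import Order.TTheory GRing.Theory Num.Theory GroupScope.

(* With T(w) = des(w) + des(w^-1), write des(w^-1) = n/2 + F(w)/2 where F is the sum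
   over the simple roots of the signs e_i = +1 or -1, with e_i(w) = +1 iff s_i is a left
   descent of w; hence T - E T = Y/2 with Y(w) = F(w) + F(w^-1).
   Upper bound: apart from three of them, the generators split into two classes of
   pairwise commuting ones; within a class the e_i behave like independent fair
   coins, because w -> s_i w flips e_i alone, so the fourth moment of each partial
   sum is at most 3 n^2, and (a+b)^4 <= 8 (a^4 + b^4) puts the pieces together.
   Lower bound: let Z be the sum of m signs e_i, with i ranging over every other node
   of the path part of the Dynkin diagram. Then E Z^2 = m, and E Z F >= m/3 because
   adjacent signs have correlation at least -1/3, while E e_i(w) F(w^-1) >= 0 because
   one kind of descent set is monotone along the weak order on the other side.
   Expanding E (Y - Z/3)^2 >= 0 and then E (Y^2 - m/9)^2 >= 0 gives a bound of order
   m^2 on E Y^4. The descents themselves are computed with an exchange argument on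
   roots represented as pairs of points of the permutation representation. *)

(** * Word length and its bounded search *)

Section WordLength.
Variables (gT : finGroupType) (S : {set gT}).
Implicit Types (s v w : gT) (k : nat).

Lemma mem_powS_gen k w : w \in powS S k -> w \in <<S>>.
Proof.
elim: k w => [|k IHk] w /=; first by rewrite inE => /eqP->; rewrite group1.
by case/mulsgP=> v s /IHk Gv Ss ->; rewrite groupM // mem_gen.
Qed.

Lemma powSl k s w : s \in S -> w \in powS S k -> s * w \in powS S k.+1.
Proof.
move=> Ss; elim: k w => [|k IHk] w.
  by rewrite inE => /eqP->; rewrite mulg1 -[s]mul1g mem_mulg ?set11.
by case/mulsgP=> v t /IHk sv St ->; rewrite mulgA mem_mulg.
Qed.

(** Cutting letters off the end of a shortest word leaves shortest words, so all smaller lengths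
    occur; this feeds the counting in [wlen_found]. *)
Lemma powS_levels k w : w \in powS S k -> (forall j, j < k -> w \notin powS S j) ->
  forall j, j <= k -> exists2 v, v \in powS S j & forall i, i < j -> v \notin powS S i.
Proof.
elim: k w => [|k IHk] w wk wmin j; first by rewrite leqn0 => /eqP->; exists w.
rewrite leq_eqVlt => /predU1P[->|]; first by exists w.
case/mulsgP: wk => v s vk Ss def_w; apply: (IHk v) => // i lt_ik.
by apply/negP=> vi; have /negP[] := wmin i.+1 lt_ik; rewrite def_w mem_mulg.
Qed.

(** If the minimal length of [w] is [m], there are elements of each exact length 0, ..., m. They are
    distinct, so [m < #|gT|] and the bounded search in [wlen] reaches [m]. *)
Lemma wlen_found w : w \in <<S>> -> w \in powS S (wlen S w).
Proof.
move=> Gw; have [k wk]: exists k, w \in powS S k.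
  have [n [c Sc ->]] := gen_prodgP Gw; exists n.
  elim: n c Sc => [|n IHn] c Sc; first by rewrite big_ord0 inE.
  by rewrite big_ord_recr mem_mulg ?IHn.
case: (ex_minnP (ex_intro (fun k => w \in powS S k) k wk)) => m wm mmin.
have lev (j : 'I_m.+1) : exists v, (v \in powS S j) &&
    [forall i : 'I_m.+1, (i < j) ==> (v \notin powS S i)].
  have wmin i : i < m -> w \notin powS S i.
    by apply: contraL => /mmin; rewrite leqNgt.
  have [v vj vmin] := powS_levels wm wmin (ltn_ord j : j <= m).
  by exists v; rewrite vj; apply/forallP=> i; apply/implyP=> /vmin.
have [f fP] := fin_all_exists lev.
have f_inj : injective f.
  move=> i j eq_f; apply/val_inj/eqP; move: (fP i) (fP j); rewrite -eq_f.
  case/andP=> fi /forallP/(_ j) min_i /andP[fj /forallP/(_ i) min_j].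
  case: (ltngtP i j) => // [lt_ij | lt_ji].
    by move: min_j; rewrite lt_ij fi.
  by move: min_i; rewrite lt_ji fj.
have le_mG : m.+1 <= #|gT| by rewrite -[m.+1]card_ord (leq_card f).
have has_w : has (fun k => w \in powS S k) (iota 0 #|gT|.+1).
  by apply/hasP; exists m; rewrite // mem_iota; lia.
have := nth_find 0 has_w; rewrite nth_iota ?add0n //.
by have := has_w; rewrite has_find size_iota.
Qed.

Lemma wlen_le k w : w \in powS S k -> wlen S w <= k.
Proof.
move=> wk; case: (ltnP #|gT| k) => [lt_Gk|le_kG].
  (* Even the default value [#|gT|.+1] of a failed search is at most [k] here. *)
  by apply: leq_trans lt_Gk; rewrite /wlen -[X in _ <= X](size_iota 0) find_size.
rewrite leqNgt; apply/negP=> lt_kw; have := before_find 0 lt_kw.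
by rewrite nth_iota ?add0n ?wk.
Qed.

Lemma wlenMl s w : s \in S -> w \in <<S>> -> wlen S (s * w) <= (wlen S w).+1.
Proof. by move=> Ss /wlen_found/(powSl Ss)/wlen_le. Qed.

Lemma wlenV w : (forall s, s \in S -> s^-1 = s) -> w \in <<S>> ->
  wlen S w^-1 = wlen S w.
Proof.
move=> SV; have powV k v : v \in powS S k -> v^-1 \in powS S k.
  elim: k v => [|k IHk] v; first by rewrite !inE => /eqP->; rewrite invg1.
  by case/mulsgP=> t s /IHk tk Ss ->; rewrite invMg SV // powSl.
have leV v : v \in <<S>> -> wlen S v^-1 <= wlen S v.
  by move=> /wlen_found/powV/wlen_le.
by move=> Gw; apply/eqP; rewrite eqn_leq leV //= -[X in wlen S X <= _]invgK leV ?groupV.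
Qed.

End WordLength.

(** * Root systems made of pairs of points *)

(* A root is a pair of points (x, y), positive when r x < r y; the group acts on
   points, hence on roots. The simple root of the generator g i is (a i, b i). *)
Record coxeter_model (X : finType) (S : {set {perm X}}) (n : nat) (r : X -> nat)
    (g : nat -> {perm X}) (a b : nat -> X) (root : rel X)
    (refl : X -> X -> {perm X}) : Prop := CoxeterModel {
  gensE : S = [set g i | i : 'I_n];
  gens_inj : forall i j, i < n -> j < n -> g i = g j -> i = j;
  gens_invol : forall i, i < n -> g i * g i = 1;
  rank_inj : injective r;
  root_neq : forall x y, root x y -> x != y;
  rootM : forall u x y, u \in <<S>> -> root x y -> root (u x) (u y);
  reflM : forall u x y, u \in <<S>> -> root x y ->
    refl x y * u = u * refl (u x) (u y);
  simple_root : forall i, i < n -> root (a i) (b i);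
  simple_lt : forall i, i < n -> r (a i) < r (b i);
  simple_refl : forall i, i < n -> refl (a i) (b i) = g i;
  simple_swapl : forall i, i < n -> g i (a i) = b i;
  simple_swapr : forall i, i < n -> g i (b i) = a i;
  simple_only : forall i x y, i < n -> root x y -> r x < r y ->
    r (g i y) < r (g i x) -> refl x y = g i;
  (* The bound 3 excludes the end of the Dynkin diagram where the types differ. *)
  far_fixl : forall i j, 2 < i < n -> j < n -> j != i -> i != j.+1 -> j != i.+1 ->
    g j (a i) = a i;
  far_fixr : forall i j, 2 < i < n -> j < n -> j != i -> i != j.+1 -> j != i.+1 ->
    g j (b i) = b i;
  chain : forall i, 2 < i -> i.+1 < n -> b i = a i.+1;
  chain_fixl : forall i, 2 < i -> i.+1 < n -> g i.+1 (a i) = a i;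
  chain_fixr : forall i, 2 < i -> i.+1 < n -> g i (b i.+1) = b i.+1 }.

Section Roots.
Variables (X : finType) (S : {set {perm X}}) (n : nat) (r : X -> nat).
Variables (g : nat -> {perm X}) (a b : nat -> X) (root : rel X).
Variables (refl : X -> X -> {perm X}).
Hypothesis M : coxeter_model S n r g a b root refl.
Implicit Types (u v w : {perm X}).

Lemma gens_in i : i < n -> g i \in S.
Proof. by move=> lt_in; rewrite (gensE M); apply/imsetP; exists (Ordinal lt_in). Qed.

Lemma gens_gen i : i < n -> g i \in <<S>>.
Proof. by move/gens_in/mem_gen. Qed.

Lemma gens_ex s : s \in S -> exists2 i, i < n & s = g i.
Proof. by rewrite (gensE M) => /imsetP[i _ ->]; exists i. Qed.

Lemma gensV s : s \in S -> s^-1 = s.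
Proof.
by case/gens_ex=> i lt_in ->; apply/eqP; rewrite eq_invg_mul (gens_invol M).
Qed.

(** Permutations act left to right, so the letters of the word move the root one at a time. At the
    letter that makes it negative, the root has that letter's reflection; carrying the reflection
    through the prefix cancels the letter. *)
Lemma exchange k u x y : u \in powS S k -> root x y -> r x < r y ->
  r (u y) < r (u x) -> refl x y * u \in powS S k.-1.
Proof.
move=> + xy lt_xy; elim: k u => [|k IHk] u.
  by rewrite inE => /eqP->; rewrite !perm1; lia.
case/mulsgP=> v s vk Ss -> lt_u; have [i lt_in def_s] := gens_ex Ss.
have Gv := mem_powS_gen vk; have [lt_v | ge_v] := ltnP (r (v y)) (r (v x)).
  have := IHk v vk lt_v; case: k {IHk} vk => [|k] vk ?; last by rewrite mulgA mem_mulg.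
  by move: vk lt_v; rewrite inE => /eqP->; rewrite !perm1; lia.
have lt_v : r (v x) < r (v y).
  rewrite ltn_neqAle ge_v andbT (inj_eq (rank_inj M)) (inj_eq perm_inj).
  exact: (root_neq M xy).
rewrite mulgA (reflM M Gv xy) (simple_only M lt_in (rootM M Gv xy)) //.
  by rewrite def_s -mulgA (gens_invol M) ?mulg1.
by move: lt_u; rewrite !permM def_s.
Qed.

(** If [u] inverts the simple root, [exchange] shortens the word. Otherwise [g i * u] inverts it,
    and the same argument shows that [u] is shorter than [g i * u]. *)
Lemma descentE i u : i < n -> u \in <<S>> ->
  (wlen S (g i * u) < wlen S u) = (r (u (b i)) < r (u (a i))).
Proof.
move=> lt_in; have desc v : v \in <<S>> -> r (v (b i)) < r (v (a i)) ->
    wlen S (g i * v) < wlen S v.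
  move=> /wlen_found; case: (wlen S v) => [|k] vk lt_v.
    by move: vk lt_v (simple_lt M lt_in); rewrite inE => /eqP->; rewrite !perm1; lia.
  rewrite ltnS -(simple_refl M lt_in); apply: wlen_le.
  exact: exchange vk (simple_root M lt_in) (simple_lt M lt_in) lt_v.
move=> Gu; apply/idP/idP=> [|/(desc u Gu)//]; apply: contraTT.
rewrite -!leqNgt leq_eqVlt (inj_eq (rank_inj M)) (inj_eq perm_inj).
case/predU1P=> [eq_ab|lt_u].
  by have := simple_lt M lt_in; rewrite eq_ab ltnn.
have Ggu : g i * u \in <<S>> by rewrite groupM ?gens_gen.
have := desc _ Ggu; rewrite !permM (simple_swapl M) // (simple_swapr M) //.
by rewrite mulgA (gens_invol M) // mul1g => /(_ lt_u)/ltnW.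
Qed.

(** [des] counts right descents; these are the left descents of the inverse, because length is
    invariant under inversion. *)
Lemma desE w : w \in <<S>> ->
  des S w = (\sum_(i < n) (r (w^-1 (b i)) < r (w^-1 (a i))))%N.
Proof.
move=> Gw; rewrite /des -sum1dep_card big_mkcondr /= {1}(gensE M) big_imset /=.
  apply: eq_bigr => i _; rewrite -descentE ?groupV //.
  rewrite -[w * _]invgK invMg (gensV (gens_in _)) //.
  rewrite (wlenV gensV) ?groupM ?groupV ?gens_gen // -[w in _ < _ w]invgK.
  by rewrite (wlenV gensV) ?groupV // invgK; case: ifP.
by move=> i j _ _ /(gens_inj M) eq_ij; apply/val_inj/eq_ij.
Qed.

Definition sgn (i : nat) (u : {perm X}) : rat :=
  if r (u (b i)) < r (u (a i)) then 1%R else (-1)%R.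

Lemma sgn_flip i u : i < n -> sgn i (g i * u) = (- sgn i u)%R.
Proof.
move=> lt_in; rewrite /sgn !permM (simple_swapl M) // (simple_swapr M) //.
case: ltngtP => // /(rank_inj M)/perm_inj eq_ab.
by have := simple_lt M lt_in; rewrite eq_ab ltnn.
Qed.

Lemma sgn_far i j u : 2 < i < n -> j < n -> j != i -> i != j.+1 -> j != i.+1 ->
  sgn i (g j * u) = sgn i u.
Proof. by move=> ? ? ? ? ?; rewrite /sgn !permM (far_fixl M) ?(far_fixr M). Qed.

(* If s_j is a right descent of s_i u, and s_i a left descent of u, then
   l(u s_j) <= 1 + l(s_i u s_j) <= l(s_i u) < l(u). *)
Lemma descent_mono i j u : i < n -> j < n -> u \in <<S>> -> sgn i u = 1%R ->
  (sgn j (g i * u)^-1 <= sgn j u^-1)%R.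
Proof.
move=> lt_in lt_jn Gu; have Sg := gens_in; have Gg := gens_gen.
have lenV v : v \in <<S>> -> wlen S v^-1 = wlen S v by apply: wlenV gensV.
have sgnV v : v \in <<S>> -> sgn j v^-1 = if wlen S (v * g j) < wlen S v then 1%R else (-1)%R.
  move=> Gv; rewrite /sgn -descentE ?groupV // lenV //.
  by rewrite -lenV ?groupM ?groupV ?Gg // invMg invgK (gensV (Sg _ lt_jn)).
rewrite !sgnV ?groupM ?Gg // {1}/sgn -descentE //.
case: ifP => // lt_gu _; case: ifP => [lt_guj|_]; last by case: ifP.
suff -> : wlen S (u * g j) < wlen S u by [].
have /(wlenMl (Sg _ lt_in)): g i * u * g j \in <<S>> by rewrite !groupM ?Gg.
rewrite -(mulgA (g i) u) (mulgA (g i) (g i)) (gens_invol M) // mul1g (mulgA (g i)).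
by move/leq_trans/(_ lt_guj) => le_uj; apply: leq_ltn_trans le_uj lt_gu.
Qed.

(** The product of two adjacent simple reflections is a 3-cycle on the points [a i], [a i.+1],
    [b i.+1], which span both simple roots. *)
Lemma sgn_rot i : 2 < i -> i.+1 < n -> exists2 c, c \in <<S>> &
  forall u, [/\ sgn i (c * u) = sgn i.+1 u, sgn i.+1 (c * (c * u)) = sgn i u
    & sgn i (c * (c * u)) = sgn i.+1 (c * u)].
Proof.
move=> i3 lt_in; have lt_in' := ltnW lt_in.
have ca : (g i.+1 * g i) (a i) = a i.+1.
  by rewrite permM (chain_fixl M) // (simple_swapl M) // (chain M).
have cb : (g i.+1 * g i) (a i.+1) = b i.+1.
  by rewrite permM (simple_swapl M) // (chain_fixr M).
have cc : (g i.+1 * g i) (b i.+1) = a i.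
  by rewrite permM (simple_swapr M) // -(chain M) // (simple_swapr M).
exists (g i.+1 * g i) => [|u]; first by rewrite groupM ?gens_gen.
by rewrite /sgn (chain M) // !(permM _ u) !(permM _ (_ * u)) !(permM _ u) ca cb cc ca.
Qed.

End Roots.

(** * Moments of sums of signs *)

Section Signs.
Local Open Scope ring_scope.
Variables (gT : finGroupType) (G : {group gT}) (n : nat).
Variables (g : nat -> gT) (e : nat -> gT -> rat).
Implicit Types (f : gT -> rat) (u : gT) (h : gT).
Local Notation N := (#|G|%:R : rat).

Lemma sum_cst (x : rat) : \sum_(u in G) x = x * N.
Proof. by rewrite sumr_const mulr_natr. Qed.

Lemma sum_affine (x y : rat) f :
  \sum_(u in G) (x + y * f u) = x * N + y * \sum_(u in G) f u.
Proof. by rewrite big_split /= sum_cst mulr_sumr. Qed.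

Lemma sum_shift f h : h \in G -> \sum_(u in G) f (h * u)%g = \sum_(u in G) f u.
Proof.
move=> Gh; rewrite [RHS](reindex_inj (mulgI h)) /=.
by apply: eq_bigl => u; rewrite groupMl.
Qed.

Lemma sum_inv f : \sum_(u in G) f u^-1%g = \sum_(u in G) f u.
Proof.
rewrite [RHS](reindex_inj invg_inj) /=.
by apply: eq_bigl => u; rewrite groupV.
Qed.

Lemma sum_odd f h : h \in G -> (forall u, u \in G -> f (h * u)%g = - f u) ->
  \sum_(u in G) f u = 0.
Proof.
move=> Gh f_odd; suff: \sum_(u in G) f u = - \sum_(u in G) f u by lra.
by rewrite -[LHS](sum_shift _ Gh) -sumrN; apply: eq_bigr.
Qed.

Hypothesis Gg : forall i, (i < n)%N -> g i \in G.
Hypothesis gg : forall i, (i < n)%N -> (g i * g i = 1)%g.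
Hypothesis e2 : forall i u, e i u ^+ 2 = 1.
Hypothesis e_flip : forall i u, (i < n)%N -> e i (g i * u)%g = - e i u.

Lemma sum_sign i : (i < n)%N -> \sum_(u in G) e i u = 0.
Proof. by move=> lt_in; apply: (sum_odd (Gg lt_in)) => u _; rewrite e_flip. Qed.

(* Toggling one sign while keeping the others kills all odd terms, so that the
   signs behave like independent fair coins. *)
Lemma moments_commuting (J : seq nat) : uniq J -> {in J, forall i, (i < n)%N} ->
    {in J &, forall i j u, i != j -> e i (g j * u)%g = e i u} ->
  let Z u := \sum_(i <- J) e i u in
  \sum_(u in G) Z u ^+ 2 = (size J)%:R * N /\
  \sum_(u in G) Z u ^+ 4 <= 3 * (size J)%:R ^+ 2 * N.
Proof.
elim: J => [|i J IHJ] /= => [_ _ _|/andP[JNi uJ] lt_J e_J].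
  rewrite (eq_bigr (fun _ => 0)) => [|u _]; last by rewrite big_nil.
  rewrite [X in _ /\ X <= _](eq_bigr (fun _ => 0)) => [|u _]; last by rewrite big_nil.
  by rewrite !big1 //; split; rewrite mulr0n; lra.
have lt_in : (i < n)%N by apply: lt_J; rewrite mem_head.
have [||{IHJ}] := IHJ uJ.
- by move=> j Jj; apply: lt_J; rewrite inE Jj orbT.
- by move=> j k Jj Jk; apply: e_J; rewrite inE ?Jj ?Jk orbT.
set Z := fun u => \sum_(j <- J) e j u => Z2 Z4.
have Z_i u : Z (g i * u)%g = Z u.
  apply: eq_big_seq => j Jj; apply: e_J; rewrite ?mem_head ?inE ?Jj ?orbT //.
  by apply: contraNneq JNi => <-.
have odd k : \sum_(u in G) Z u ^+ k * e i u = 0.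
  by apply: (sum_odd (Gg lt_in)) => u _; rewrite Z_i e_flip // mulrN.
have N0 : 0 <= N by rewrite ler0n.
split.
  rewrite (eq_bigr (fun u => Z u ^+ 2 + (2 * (Z u ^+ 1 * e i u) + 1))) => [|u _].
    by rewrite !big_split /= -mulr_sumr odd Z2 sum_cst -natr1; lra.
  by rewrite big_cons -/(Z u) sqrrD e2; ring.
rewrite (eq_bigr (fun u => Z u ^+ 4 + (4 * (Z u ^+ 3 * e i u) +
    (6 * Z u ^+ 2 + (4 * (Z u ^+ 1 * e i u) + 1))))) => [|u _].
  rewrite !big_split /= -!mulr_sumr !odd Z2 sum_cst -natr1.
  (* With m signs so far, the new bound is 3m^2 + 6m + 1, which falls short of 3(m+1)^2 by 2. *)
  have : 0 <= 2 * N by lra.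
  nra.
rewrite big_cons -/(Z u).
have -> : (e i u + Z u) ^+ 4 = Z u ^+ 4 + (4 * (Z u ^+ 3 * e i u) +
    (6 * Z u ^+ 2 * e i u ^+ 2 + (4 * (Z u ^+ 1 * e i u) * e i u ^+ 2 + (e i u ^+ 2) ^+ 2))).
  by ring.
by rewrite e2; ring.
Qed.

Hypothesis e_far : forall i j u, (2 < i < n)%N -> (j < n)%N -> j != i ->
  i != j.+1 -> j != i.+1 -> e i (g j * u)%g = e i u.
Hypothesis e_rot : forall i, (2 < i)%N -> (i.+1 < n)%N -> exists2 c, c \in G &
  forall u, [/\ e i (c * u)%g = e i.+1 u, e i.+1 (c * (c * u))%g = e i u
    & e i (c * (c * u))%g = e i.+1 (c * u)%g].
Hypothesis e_mono : forall i j u, (i < n)%N -> (j < n)%N -> u \in G ->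
  e i u = 1 -> e j (g i * u)^-1%g <= e j u^-1%g.

Lemma e_same_parity i j u : (2 < i < n)%N -> (2 < j < n)%N -> odd i = odd j ->
  i != j -> e i (g j * u)%g = e i u.
Proof.
move=> i_n /andP[_ lt_jn] odd_ij neq_ij; apply: e_far => //; first by rewrite eq_sym.
  by apply/eqP=> def_i; move: odd_ij; rewrite def_i /=; case: odd.
by apply/eqP=> def_j; move: odd_ij; rewrite def_j /=; case: odd.
Qed.

Let F u : rat := \sum_(0 <= i < n) e i u.

Lemma signP i u : e i u = 1 \/ e i u = - 1.
Proof.
by have /eqP := e2 i u; rewrite sqrf_eq1 => /orP[]/eqP; [left | right].
Qed.

(** The inequality (s+t)^2 <= 2(s^2+t^2) is applied twice. *)
Lemma ler_expr4D (x y : rat) : (x + y) ^+ 4 <= 8 * (x ^+ 4 + y ^+ 4).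
Proof.
have sq (s t : rat) : (s + t) ^+ 2 <= 2 * (s ^+ 2 + t ^+ 2).
  by have := sqr_ge0 (s - t); rewrite sqrrB sqrrD; lra.
have := sq (x ^+ 2) (y ^+ 2); rewrite -!exprM.
suff : (x + y) ^+ 4 <= (2 * (x ^+ 2 + y ^+ 2)) ^+ 2 by rewrite exprMn; lra.
have -> : (x + y) ^+ 4 = ((x + y) ^+ 2) ^+ 2 by ring.
apply: lerXn2r; rewrite ?nnegrE ?sqr_ge0 ?sq //.
by have := sqr_ge0 x; have := sqr_ge0 y; lra.
Qed.

Lemma fourth_moment_F : \sum_(u in G) F u ^+ 4 <= (648 + 384 * n%:R ^+ 2) * N.
Proof.
(* From node 3 on the diagram is a path, so nodes of equal parity are never adjacent and their signs
   can be toggled independently. *)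
pose J p := [seq i <- index_iota 3 n | odd i == p].
have sizeJ p : (size (J p))%:R <= n%:R :> rat.
  rewrite ler_nat size_filter; apply: leq_trans (count_size _ _) _.
  by rewrite size_iota leq_subr.
have Jn p i : i \in J p -> (2 < i < n)%N && (odd i == p).
  by rewrite mem_filter mem_index_iota andbC.
have momJ p : \sum_(u in G) (\sum_(i <- J p) e i u) ^+ 4 <= 3 * n%:R ^+ 2 * N.
  have [|||_ le4] := @moments_commuting (J p).
  - by rewrite filter_uniq ?iota_uniq.
  - by move=> i /Jn/andP[/andP[]].
  - move=> i j /Jn/andP[lt_in /eqP odd_i] /Jn/andP[lt_jn /eqP odd_j] u.
    by apply: e_same_parity; rewrite ?odd_i.
  apply: le_trans le4 _; rewrite ler_wpM2r ?ler0n // ler_wpM2l // lerXn2r ?nnegrE ?ler0n //.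
pose H u := \sum_(0 <= i < minn 3 n) e i u.
have F_split u : F u = H u + (\sum_(i <- J true) e i u + \sum_(i <- J false) e i u).
  rewrite /F /H !big_filter.
  have -> : index_iota 0 n = index_iota 0 (minn 3 n) ++ index_iota 3 n.
    rewrite /index_iota; case: (leqP n 3) => [le_n3 | lt3n].
      by rewrite (eqP le_n3 : n - 3 = 0)%N cats0.
    by rewrite -iotaD; congr (iota _ _); lia.
  rewrite big_cat [X in _ + X = _](bigID odd) /=; congr (_ + (_ + _)).
    by apply: eq_bigl => i; case: odd.
  by apply: eq_bigl => i; case: odd.
(* [H] is a sum of at most three signs, and 81 = 3^4. *)
have H4 u : H u ^+ 4 <= 81.
  have lt_e i : - 1 <= e i u <= 1 by case: (signP i u) => ->.
  have /andP[H_ge H_le] : - 3 <= H u <= 3.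
    rewrite /H; case: n => [|[|[|m]]]; rewrite ?(@big_geq _ _ _ _ 0%N) //.
    - by rewrite big_nat1; have := lt_e 0%N; lra.
    - by rewrite big_nat_recl // big_nat1; have := lt_e 0%N; have := lt_e 1%N; lra.
    rewrite (minn_idPl _) // 2?big_nat_recl // big_nat1.
    by have := lt_e 0%N; have := lt_e 1%N; have := lt_e 2%N; lra.
  have -> : H u ^+ 4 = 81 - (3 - H u) * (3 + H u) * (9 + H u ^+ 2) by ring.
  rewrite lerBlDr lerDl; have sqH := sqr_ge0 (H u).
  by apply: mulr_ge0; [apply: mulr_ge0; lra | lra].
(* Two uses of [ler_expr4D]: 648 = 8 * 81 bounds the part of [H], and 64 = 8 * 8 multiplies the two
   parity classes. Each class contributes at most 3n^2, whence 384 = 64 * 6. *)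
apply: le_trans (_ : \sum_(u in G) (648 + 64 * ((\sum_(i <- J true) e i u) ^+ 4
    + (\sum_(i <- J false) e i u) ^+ 4)) <= _).
  apply: ler_sum => u _; rewrite F_split.
  set A := \sum_(i <- J true) _; set B := \sum_(i <- J false) _.
  have := ler_expr4D (H u) (A + B); have := ler_expr4D A B; have := H4 u; lra.
rewrite sum_affine big_split /=.
have := momJ true; have := momJ false.
have : 0 <= N by rewrite ler0n.
lra.
Qed.

(* Signs x, y, z satisfy xy + yz + zx >= -1; the rotation c permutes cyclically the
   signs of two adjacent simple roots and of minus their sum. *)
Lemma sum_adjacent i : (2 < i)%N -> (i.+1 < n)%N ->
  - (1/3) * N <= \sum_(u in G) e i u * e i.+1 u.
Proof.
move=> i3 lt_in; have [c Gc rot] := e_rot i3 lt_in.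
have E1 : \sum_(u in G) e i.+1 u * e i.+1 (c * u)%g = \sum_(u in G) e i u * e i.+1 u.
  rewrite -[RHS](sum_shift _ Gc); apply: eq_bigr => u _.
  by have [-> _ _] := rot u.
have E2 : \sum_(u in G) e i.+1 (c * u)%g * e i u = \sum_(u in G) e i u * e i.+1 u.
  rewrite -[RHS](sum_shift _ Gc) -[RHS](sum_shift _ Gc); apply: eq_bigr => u _.
  by have [_ -> ->] := rot u.
suff: \sum_(u in G) (- 1 : rat) <= \sum_(u in G) (e i u * e i.+1 u +
    (e i.+1 u * e i.+1 (c * u)%g + e i.+1 (c * u)%g * e i u)).
  by rewrite sum_cst !big_split /= E1 E2; lra.
apply: ler_sum => u _.
by case: (signP i u) (signP i.+1 u) (signP i.+1 (c * u)%g) =>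
  -> [] -> [] ->.
Qed.

(** The diagonal term gives 1, each of the at most two neighbours at least -1/3, and all other signs
    are uncorrelated with [e i]. The condition [3 < i] keeps the left neighbour on the path. *)
Lemma sum_sign_F i : (3 < i < n)%N -> 1/3 * N <= \sum_(u in G) e i u * F u.
Proof.
case/andP=> i3 lt_in; have N0 : 0 <= N by rewrite ler0n.
have [ni1 ni2 ni3] : [/\ i != i.-1, i != i.+1 & i.-1 != i.+1] by split; lia.
have [def_i ip] : i.-1.+1 = i /\ (2 < i.-1)%N by lia.
have -> : \sum_(u in G) e i u * F u = \sum_(0 <= j < n) \sum_(u in G) e i u * e j u.
  by rewrite exchange_big; apply: eq_bigr => u _; rewrite mulr_sumr.
(* Kronecker delta; it puts the three exceptional indices into one termwise bound, and an absent
   right neighbour simply contributes 0. *)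
pose D (j k : nat) : rat := if j == k then 1 else 0.
apply: le_trans (_ : \sum_(0 <= j < n) (D j i - 1/3 * D j i.-1 - 1/3 * D j i.+1) * N <= _).
  rewrite -mulr_suml; apply: (ler_wpM2r N0); rewrite !big_split /= !sumrN -!mulr_sumr -!big_mkcond.
  by rewrite !big_nat1_eq /=; case: (i.+1 < n)%N; case: (i.-1 < n)%N; rewrite lt_in; lra.
apply: ler_sum_nat => j /andP[_ lt_jn]; rewrite /D {D}.
have [eq_ji | neq_ji] := eqVneq j i.
  rewrite eq_ji (negPf ni1) (negPf ni2).
  rewrite (eq_bigr (fun _ => 1)) => [|u _]; last by rewrite -expr2 e2.
  rewrite sum_cst; lra.
have [eq_ji | neq_ji1] := eqVneq j i.-1.
  rewrite eq_ji (negPf ni3); under eq_bigr do rewrite mulrC.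
  have := @sum_adjacent i.-1; rewrite def_i => /(_ ip lt_in); lra.
have [eq_ji | neq_ji2] := eqVneq j i.+1.
  have := @sum_adjacent i (ltnW i3); rewrite -eq_ji => /(_ lt_jn); lra.
(* For [j] neither equal nor adjacent to [i], translation by [g j] flips [e j] and preserves
   [e i]. *)
rewrite (sum_odd (Gg lt_jn)) ?subr0 ?mulr0 ?mul0r ?subr0 // => u _.
rewrite e_flip // mulrN e_far ?(ltnW i3) //.
by apply: contraNneq neq_ji1 => ->.
Qed.

(** Pair [u] with [g i * u]: the values of [e i] are opposite, and by [e_mono] the member with
    [e i = 1] has the larger value of F at the inverse, so each pair contributes a nonnegative
    amount. *)
Lemma sum_sign_Finv i : (i < n)%N -> 0 <= \sum_(u in G) e i u * F u^-1%g.
Proof.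
move=> lt_in; have mono u : u \in G -> e i u = 1 -> F (g i * u)^-1%g <= F u^-1%g.
  by move=> Gu e1; apply: ler_sum_nat => j /andP[_ lt_jn]; apply: e_mono.
suff: 0 <= \sum_(u in G) (e i u * F u^-1%g + e i (g i * u)%g * F (g i * u)^-1%g).
  by rewrite big_split /= (sum_shift (fun u => e i u * F u^-1%g)) ?Gg //; lra.
apply: sumr_ge0 => u Gu; rewrite e_flip //.
case: (signP i u) => e_u; rewrite e_u; first by have := mono u Gu e_u; lra.
have e_gu : e i (g i * u)%g = 1 by rewrite e_flip // e_u opprK.
have := mono _ _ e_gu; rewrite groupM ?Gg // mulgA gg // mul1g => /(_ isT).
lra.
Qed.

Let Y u : rat := F u + F u^-1%g.

Lemma sum_Y : \sum_(u in G) Y u = 0.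
Proof.
have F0 : \sum_(u in G) F u = 0.
  rewrite exchange_big big_nat_cond big1 // => i; rewrite andbT => /andP[_ lt_in].
  exact: sum_sign.
by rewrite big_split /= (sum_inv F) F0 addr0.
Qed.

Lemma fourth_moment_Y_le : \sum_(u in G) Y u ^+ 4 <= 16 * ((648 + 384 * n%:R ^+ 2) * N).
Proof.
apply: le_trans (_ : \sum_(u in G) 8 * (F u ^+ 4 + F u^-1%g ^+ 4) <= _).
  by apply: ler_sum => u _; apply: ler_expr4D.
rewrite -mulr_sumr big_split /= (sum_inv (fun u => F u ^+ 4)).
by have := fourth_moment_F; lra.
Qed.

(* The signs of every other simple root are uncorrelated, so their sum Z has
   variance m, and Z correlates positively with Y. *)
Lemma fourth_moment_Y_ge (m : nat) : (m.*2 + 3 <= n)%N ->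
  (m%:R / 9) ^+ 2 * N <= \sum_(u in G) Y u ^+ 4.
Proof.
(* Even nodes 4, 6, ..., 2m+2: they start at 4 because [sum_sign_F] needs [3 < i], and 2m+3 <= n
   keeps the last one in range. *)
move=> le_mn; pose J := [seq k.*2 + 4 | k <- iota 0 m]%N.
have Jn i : i \in J -> (3 < i < n)%N && ~~ odd i.
  case/mapP=> k; rewrite mem_iota => /andP[_ lt_km] ->.
  by rewrite oddD odd_double andbT; lia.
have N0 : 0 <= N by rewrite ler0n.
have uJ : uniq J by rewrite map_inj_uniq ?iota_uniq // => k l; lia.
have [||Z2 _] := moments_commuting uJ.
- by move=> i /Jn/andP[/andP[]].
- move=> i j /Jn/andP[/andP[i3 lt_in] odd_i] /Jn/andP[/andP[j3 lt_jn] odd_j] u.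
  by apply: e_same_parity; rewrite ?(ltnW i3) ?(ltnW j3) // (negPf odd_i) (negPf odd_j).
rewrite size_map size_iota in Z2.
set Z := fun u => \sum_(i <- J) e i u in Z2.
have ZY : m%:R / 3 * N <= \sum_(u in G) Z u * Y u.
  have -> : \sum_(u in G) Z u * Y u = \sum_(i <- J) \sum_(u in G) e i u * Y u.
    by rewrite exchange_big; apply: eq_bigr => u _; rewrite mulr_suml.
  have -> : m%:R / 3 * N = \sum_(i <- J) (1/3 * N).
    by rewrite big_const_seq count_predT size_map size_iota iter_addr_0 -mulr_natr; ring.
  rewrite big_seq [X in _ <= X]big_seq; apply: ler_sum => i /Jn/andP[i_n _].
  have /andP[_ lt_in] := i_n.
  under [X in _ <= X]eq_bigr do rewrite mulrDr.
  by rewrite big_split /=; have := sum_sign_F i_n; have := sum_sign_Finv lt_in; lra.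
(* The square expands to E Y^2 >= (2/3) E ZY - (1/9) E Z^2 >= 2m/9 - m/9. *)
have Y2 : m%:R / 9 * N <= \sum_(u in G) Y u ^+ 2.
  have : 0 <= \sum_(u in G) (Y u - Z u / 3) ^+ 2.
    by apply: sumr_ge0 => u _; apply: sqr_ge0.
  have -> : \sum_(u in G) (Y u - Z u / 3) ^+ 2 = \sum_(u in G) Y u ^+ 2 +
      (- (2/3) * \sum_(u in G) Z u * Y u + 1/9 * \sum_(u in G) Z u ^+ 2).
    by rewrite !mulr_sumr -!big_split /=; apply: eq_bigr => u _; field.
  by rewrite Z2; lra.
set c := m%:R / 9 in Y2 *.
(* With E Y^2 >= c this gives E Y^4 >= 2c E Y^2 - c^2 >= c^2. *)
have : 0 <= \sum_(u in G) (Y u ^+ 2 - c) ^+ 2.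
  by apply: sumr_ge0 => u _; apply: sqr_ge0.
have -> : \sum_(u in G) (Y u ^+ 2 - c) ^+ 2 = \sum_(u in G) Y u ^+ 4 +
    (- (2 * c) * \sum_(u in G) Y u ^+ 2 + c ^+ 2 * N).
  rewrite -sum_cst !mulr_sumr -!big_split /=; apply: eq_bigr => u _; ring.
have c0 : 0 <= c by rewrite divr_ge0 ?ler0n.
have := ler_wpM2l c0 Y2; rewrite mulrA -expr2; lra.
Qed.

End Signs.

(** * From sign sums to the moments of T *)

Section ModelMoments.
Local Open Scope ring_scope.
Variables (X : finType) (S : {set {perm X}}) (n : nat) (r : X -> nat).
Variables (g : nat -> {perm X}) (a b : nat -> X) (root : rel X).
Variables (refl : X -> X -> {perm X}).
Hypothesis M : coxeter_model S n r g a b root refl.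

Let e := sgn r a b.
Let Y u : rat := \sum_(0 <= i < n) e i u + \sum_(0 <= i < n) e i u^-1%g.
Local Notation N := (#|<<S>>%g|%:R : rat).

Lemma tstatE u : u \in <<S>>%g -> (tstat S u)%:R = n%:R + Y u / 2.
Proof.
have desR w : w \in <<S>>%g ->
    (des S w)%:R = (n%:R + \sum_(0 <= i < n) e i w^-1%g) / 2 :> rat.
  move=> Gw; rewrite (desE M) // natr_sum big_mkord -[in n%:R](card_ord n).
  rewrite -sum1_card natr_sum -big_split mulr_suml; apply: eq_bigr => i _ /=.
  by rewrite /e /sgn; case: ifP => _ /=; lra.
by move=> Gu; rewrite /tstat natrD !desR ?groupV // invgK /Y; field.
Qed.

Lemma card_gt0 : 0 < N.
Proof. by rewrite ltr0n cardG_gt0. Qed.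

Let e2 i u : e i u ^+ 2 = 1.
Proof. by rewrite /e /sgn; case: ifP => _; lra. Qed.

Lemma meanTE : meanT S = n%:R.
Proof.
have N0 := card_gt0; rewrite /meanT (eq_bigr (fun u => n%:R + 2^-1 * Y u)) => [|u Gu].
  rewrite sum_affine (sum_Y (G := <<S>>%G) (gens_gen M) (sgn_flip M)).
  by field; rewrite lt0r_neq0.
by rewrite tstatE // mulrC.
Qed.

Lemma m4TE : m4T S = (\sum_(u in <<S>>%g) Y u ^+ 4) / (16 * N).
Proof.
have N0 := card_gt0; rewrite /m4T meanTE.
rewrite (eq_bigr (fun u => 16^-1 * Y u ^+ 4)) => [|u Gu].
  by rewrite -mulr_sumr; field; rewrite lt0r_neq0.
by rewrite tstatE //; field.
Qed.

Lemma m4T_le : m4T S <= 648 + 384 * n%:R ^+ 2.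
Proof.
have N16 : 0 < 16 * N by have := card_gt0; lra.
rewrite m4TE (ler_pdivrMr _ _ N16).
have := fourth_moment_Y_le (G := <<S>>%G) (gens_gen M) e2 (sgn_flip M) (sgn_far M).
by rewrite -/e -/Y; lra.
Qed.

Lemma m4T_ge (m : nat) : (m.*2 + 3 <= n)%N -> (m%:R / 36) ^+ 2 <= m4T S.
Proof.
move=> le_mn; have N16 : 0 < 16 * N by have := card_gt0; lra.
rewrite m4TE (ler_pdivlMr _ _ N16).
have := fourth_moment_Y_ge (G := <<S>>%G) (gens_gen M) (gens_invol M) e2
  (sgn_flip M) (sgn_far M) (sgn_rot M) (descent_mono M) le_mn.
by rewrite -/e -/Y; lra.
Qed.

End ModelMoments.

Lemma order_n2_models (X : nat -> finType) (S : forall n, {set {perm X n}}) :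
  (forall n, exists r g a b root refl,
    @coxeter_model (X n.+2) (S n.+2) n.+2 r g a b root refl) ->
  order_n2 (fun n => m4T (S n)).
Proof.
(* The lower bound is used with m = floor((n-4)/2); for n >= 10 one has 4m >= n, so m/36 >= n/144.
   Also 648 <= 16 n^2 there, whence 400 = 384 + 16. *)
move=> models; exists ((1 / 144) ^+ 2)%R, 400%R; split; [lra | split; [lra |]].
have sq_le (x y : rat) : (0 <= x -> x <= y -> x ^+ 2 <= y ^+ 2)%R.
  by move=> x0 le_xy; rewrite lerXn2r ?nnegrE //; lra.
exists 10 => -[//|[//|n]] le_n.
have [r [g [a [b [root [refl M]]]]]] := models n.
have le_m : n.+2 <= (n.+2 - 4)./2 * 4 by lia.
have le_mR : (n.+2%:R <= (n.+2 - 4)./2%:R * 4 :> rat)%R by rewrite -natrM ler_nat.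
have le10 : (10 <= n.+2%:R :> rat)%R by rewrite ler_nat.
split.
  have m_ok : (n.+2 - 4)./2.*2 + 3 <= n.+2 by lia.
  apply: le_trans (m4T_ge M m_ok); rewrite -exprMn.
  by apply: sq_le; lra.
apply: le_trans (m4T_le M) _; nra.
Qed.

(** * The three families *)

(** The pair (x, y) of distinct points stands for a root of type A, and its reflection is the
    transposition of x and y. *)
Lemma coxA_model n : exists r g a b root refl,
  @coxeter_model 'I_n.+3 (coxA n.+2) n.+2 r g a b root refl.
Proof.
pose a i : 'I_n.+3 := inord i; pose b i : 'I_n.+3 := inord i.+1.
have va i : i <= n.+2 -> val (a i) = i by move=> ?; rewrite /= inordK.
have vb i : i < n.+2 -> val (b i) = i.+1 by move=> ?; rewrite /= inordK.
have gE i z : i < n.+2 -> val (tperm (a i) (b i) z) =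
    if val z == i then i.+1 else if val z == i.+1 then i else val z.
  move=> lt_in; have ai := va i (ltnW lt_in); have bi := vb i lt_in.
  case: tpermP => [->|->|za zb]; rewrite ?ai ?bi ?eqxx //; first by rewrite gtn_eqF.
  case: eqP => [zi|_]; first by case: za; apply: val_inj; rewrite ai.
  by case: eqP => // zi; case: zb; apply: val_inj; rewrite bi.
exists val, (fun i => tperm (a i) (b i)), a, b, (fun x y => x != y), (@tperm _).
split=> //.
- apply/setP=> s; apply/imset2P/imsetP.
    case=> i j _; rewrite !inE => /= /eqP eq_ji ->.
    have lt_in : i < n.+2 by have := ltn_ord j; lia.
    exists (Ordinal lt_in) => //=; congr tperm; apply: val_inj.
      by rewrite va // ltnW.
    by rewrite vb.
  case=> i _ ->; have lt_in := ltn_ord i.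
  by exists (a i) (b i) => //; rewrite !inE /= vb ?va // ltnW.
- move=> i j lt_in lt_jn eq_g; have := gE i (a i) lt_in.
  by rewrite eq_g gE // va 1?ltnW // eqxx; do 2?case: eqP; lia.
- by move=> i _; rewrite tperm2.
- exact: val_inj.
- by move=> u x y _; rewrite (inj_eq perm_inj).
- by move=> u x y _ _; rewrite conjgC tpermJ.
- by move=> i lt_in; apply/eqP=> /(congr1 val); rewrite (va i (ltnW lt_in)) vb //; lia.
- by move=> i lt_in; rewrite (va i (ltnW lt_in)) vb.
- by move=> i _; rewrite tpermL.
- by move=> i _; rewrite tpermR.
- move=> i x y lt_in _ lt_xy; rewrite !gE // => lt_g.
  (* An adjacent transposition inverts only the pair that it swaps. *)
  have [xi yi] : val x = i /\ val y = i.+1 by move: lt_xy lt_g; do 4?case: eqP; lia.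
  by congr tperm; apply: val_inj; rewrite ?(va i (ltnW lt_in)) ?vb.
- by move=> i j lt_in lt_jn ? ? ?; apply: val_inj; rewrite gE // va; try lia; do 2?case: eqP; lia.
- by move=> i j lt_in lt_jn ? ? ?; apply: val_inj; rewrite gE // vb; try lia; do 2?case: eqP; lia.
- by move=> i i3 lt_in; apply: val_inj; rewrite gE // va; try lia; do 2?case: eqP; lia.
- by move=> i i3 lt_in; apply: val_inj; rewrite gE ?vb //; do 2?case: eqP; lia.
Qed.

(** * Reflections acting on signed letters *)

Section SignedPermutations.
Variable K : nat.
Local Notation point := ('I_K.+1 * bool)%type.
Implicit Types (x y z : point) (u : {perm point}).

Definition opp z : point := (z.1, ~~ z.2).

(* The order -(K+1) < ... < -1 < 1 < ... < K+1 of the signed letters. *)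
Definition rank z : nat := if z.2 then K - z.1 else K + z.1.+1.

Definition letter (k : nat) (s : bool) : point := (inord k, s).

(** Swaps x with y and -x with -y. If y = -x both transpositions coincide and would cancel, so one
    is dropped, leaving a sign change. *)
Definition srefl x y : {perm point} :=
  tperm x y * (if y == opp x then 1 else tperm (opp x) (opp y)).

Lemma rank_bij : injective rank.
Proof.
move=> [i s] [j t]; rewrite /rank /=; have := ltn_ord i; have := ltn_ord j.
case: s t => [] [] ? ? ?; try (exfalso; lia).
all: by congr (_, _); apply: val_inj => /=; lia.
Qed.

Lemma rank_le z : rank z <= K.*2.+1.
Proof. by case: z => i s; have := ltn_ord i; rewrite /rank /=; case: s; lia. Qed.

Lemma rank_opp z : rank (opp z) = K.*2.+1 - rank z.
Proof. by case: z => i s; have := ltn_ord i; rewrite /rank /=; case: s => /=; lia. Qed.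

Lemma rank_letter k s : k <= K -> rank (letter k s) = if s then K - k else K + k.+1.
Proof. by move=> le_kK; rewrite /rank /= inordK. Qed.

Lemma oppK : involutive opp.
Proof. by case=> i s; rewrite /opp /= negbK. Qed.

Lemma opp_neq z : opp z != z.
Proof. by case: z => i []; rewrite /opp xpair_eqE andbF. Qed.

(** Since [rank] is injective, this reduces identities between signed permutations to case analysis
    on natural numbers. *)
Lemma rank_srefl x y z : x != y -> rank (srefl x y z) =
  if rank z == rank x then rank y else if rank z == rank y then rank x else
  if rank z == rank (opp x) then rank (opp y) else
  if rank z == rank (opp y) then rank (opp x) else rank z.
Proof.
move=> neq_xy; rewrite !(inj_eq rank_bij) /srefl permM.
have [-> | neq_y] := eqVneq y (opp x).
  rewrite perm1 oppK; case: tpermP => [->|->|/eqP/negPf-> /eqP/negPf->];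
    by rewrite ?eqxx ?(negPf (opp_neq _)).
have nx := opp_neq x; have ny := opp_neq y.
have nyx : y != opp x by [].
have nxy : x != opp y by rewrite -(inv_eq oppK) eq_sym.
have noo : opp x != opp y by rewrite (inj_eq (inv_inj oppK)).
case: (tpermP x y z) => [->|->|/eqP zx /eqP zy].
- by rewrite eqxx tpermD // eq_sym.
- by rewrite eqxx eq_sym (negPf neq_xy) tpermD // eq_sym.
rewrite (negPf zx) (negPf zy).
by case: tpermP => [->|->|/eqP/negPf-> /eqP/negPf->]; rewrite ?eqxx // eq_sym (negPf noo).
Qed.

Definition opp_perm : {perm point} := perm (inv_inj oppK).

Lemma commute_opp u z : commute u opp_perm -> u (opp z) = opp (u z).
Proof. by move/permP/(_ z); rewrite !permM !permE. Qed.

Lemma sreflJ u x y : commute u opp_perm -> srefl x y * u = u * srefl (u x) (u y).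
Proof.
move=> Cu; rewrite conjgC conjMg tpermJ /srefl -commute_opp // (inj_eq perm_inj).
by case: ifP => _; rewrite ?conj1g // tpermJ !commute_opp.
Qed.

Lemma sreflC x y : srefl x y = srefl y x.
Proof.
rewrite /srefl tpermC (tpermC (opp x)) eq_sym (can2_eq oppK oppK).
by rewrite eq_sym.
Qed.

(** With [sreflC], this shows that the pairs (x, y) and (-y, -x), two encodings of one root, have
    the same reflection. *)
Lemma srefl_opp x y : x != y -> srefl (opp x) (opp y) = srefl x y.
Proof.
move=> neq_xy; rewrite /srefl (inj_eq (inv_inj oppK)) !oppK.
have [-> | ne_y] := eqVneq y (opp x); first by rewrite oppK tpermC.
have nx := opp_neq x; have ny := opp_neq y.
have nxy : x != opp y by rewrite -(can2_eq oppK oppK) eq_sym.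
by rewrite conjgC tpermJ !tpermD // eq_sym.
Qed.

Lemma srefl_commute x y : x != y -> commute (srefl x y) opp_perm.
Proof. by move=> /srefl_opp oxy; rewrite /commute sreflJ // !permE oxy. Qed.

End SignedPermutations.

(* [d] selects type D: its special simple root is e_1 + e_2 instead of e_1, and it
   has no roots of the form e_i. *)
Section SignedModel.
Variables (n : nat) (d : bool).
Local Notation K := n.+1.
Local Notation point := ('I_n.+2 * bool)%type.
Implicit Types (x y z : point) (u : {perm point}).

(** Read as an index, [d] makes the special simple root the pair (-1, 1) in type B and (-2, 1) in
    type D. *)
Let a i : point := if i is k.+1 then letter K k false else letter K d true.
Let b i : point := letter K i false.
Let g i : {perm point} := srefl (a i) (b i).
Let root x y : bool := (x != y) && (d ==> (y != opp x)).

Let ra i : i < n.+2 -> rank (a i) = if i is k.+1 then K + i else K - d.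
Proof. by case: i => [|k] lt_in; rewrite rank_letter //; [case: d | apply: ltnW]. Qed.

Let rb i : i < n.+2 -> rank (b i) = K + i.+1.
Proof. by move=> lt_in; rewrite rank_letter. Qed.

Let rab i : i < n.+2 -> rank (a i) < rank (b i).
Proof. by move=> lt_in; rewrite ra ?rb //; case: i lt_in => [|k] _; lia. Qed.

Let ab i : i < n.+2 -> a i != b i.
Proof. by move/rab; apply: contraTneq => ->; rewrite ltnn. Qed.

Let rg i z : i < n.+2 -> rank (g i z) =
  if rank z == rank (a i) then rank (b i) else
  if rank z == rank (b i) then rank (a i) else
  if rank z == K.*2.+1 - rank (a i) then K.*2.+1 - rank (b i) else
  if rank z == K.*2.+1 - rank (b i) then K.*2.+1 - rank (a i) else rank z.
Proof. by move=> lt_in; rewrite rank_srefl ?ab // !rank_opp. Qed.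

Let g_invol i : i < n.+2 -> g i * g i = 1.
Proof.
move=> lt_in; apply/permP=> z; apply: rank_bij; rewrite permM perm1.
have := rg z lt_in; have := rg (g i z) lt_in; have := rank_le z; have := rab lt_in; have := rank_le (b i).
move: (rank z) (rank (g i z)) (rank (g i (g i z))) (rank (a i)) (rank (b i)).
move=> s t w p q.
by do ![case: eqP => ?]; lia.
Qed.

Let S : {set {perm point}} := [set g i | i : 'I_n.+2].

Let S_commute u : u \in <<S>> -> commute u (opp_perm K).
Proof.
move=> Su; apply/cent1P; suff: <<S>> \subset 'C[opp_perm K].
  by move/subsetP/(_ u Su); rewrite cent1C.
rewrite gen_subG; apply/subsetP=> _ /imsetP[i _ ->]; apply/cent1P.
by apply: srefl_commute; rewrite ab.
Qed.

(** The two alternatives are the two encodings of the simple root of [g i]. *)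
Let only i x y : i < n.+2 -> root x y -> rank x < rank y ->
  rank (g i y) < rank (g i x) ->
  (rank x = rank (a i) /\ rank y = rank (b i)) \/
  (rank x = K.*2.+1 - rank (b i) /\ rank y = K.*2.+1 - rank (a i)).
Proof.
move=> lt_in /andP[_ root_xy] lt_xy; rewrite !rg //.
(* In type D the special reflection also inverts (-1, 1) and (-2, 2); these are excluded as
   non-roots. *)
have : d ==> (rank y != K.*2.+1 - rank x) by rewrite -rank_opp (inj_eq (@rank_bij _)).
have := rank_le x; have := rank_le y; move: lt_xy.
move: (rank x) (rank y) => p q; rewrite ra // rb //.
case: i lt_in => [|k] lt_in; case: d {root_xy} => /=.
all: by do ![case: eqP => ?]; lia.
Qed.

Lemma signed_model : exists r g a b root refl,
  @coxeter_model point S n.+2 r g a b root refl.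
Proof.
exists (@rank K), g, a, b, root, (@srefl K).
split=> //.
- move=> i j lt_in lt_jn eq_g; have := rg (a i) lt_in.
  rewrite eq_g rg // eqxx !ra // !rb //.
  by case: i {eq_g} lt_in => [|i] lt_in; case: j lt_jn => [|j] lt_jn //;
     case: d; do ![case: eqP => ?]; lia.
- exact: rank_bij.
- by move=> x y /andP[].
- move=> u x y /S_commute Cu /andP[neq_xy root_xy].
  by rewrite /root (inj_eq perm_inj) neq_xy -commute_opp // (inj_eq perm_inj).
- by move=> u x y /S_commute Cu _; apply: sreflJ.
- move=> i lt_in; rewrite /root ab //=; apply/implyP=> d1.
  rewrite -(inj_eq (@rank_bij _)) rank_opp ra // rb // d1.
  by case: i lt_in => [|i] lt_in; lia.
- by move=> i lt_in; apply: rank_bij; rewrite rg // eqxx.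
- move=> i lt_in; apply: rank_bij; rewrite rg // eqxx gtn_eqF //; exact: rab.
- move=> i x y lt_in root_xy lt_xy lt_g; rewrite /g.
  case: (only lt_in root_xy lt_xy lt_g) => [] []; rewrite -?rank_opp.
    by move=> /rank_bij-> /rank_bij->.
  by move=> /rank_bij-> /rank_bij->; rewrite sreflC srefl_opp ?ab.
all: move=> i.
- move=> j /andP[i3 lt_in] lt_jn n1 n2 n3; apply: rank_bij; rewrite rg // !ra // rb //.
  by case: i i3 {lt_in} n1 n2 n3 => // k; case: j {lt_jn} => [|j]; case: d; do ![case: eqP => ?]; lia.
- move=> j /andP[i3 lt_in] lt_jn n1 n2 n3; apply: rank_bij; rewrite rg // ra // !rb //.
  by case: j {lt_jn} n1 n2 n3 => [|j]; case: d; do ![case: eqP => ?]; lia.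
- move=> i3 lt_in; apply: rank_bij; rewrite rg // !ra ?rb // 1?ltnW //.
  by case: i i3 {lt_in} => // k ?; do ![case: eqP => ?]; lia.
- move=> i3 lt_in; apply: rank_bij; rewrite rg 1?ltnW // !ra ?rb // 1?ltnW //.
  by case: i i3 {lt_in} => // k ?; do ![case: eqP => ?]; lia.
Qed.

Lemma adjBE : adjB n.+2 = [set g i | i : 'I_n.+2 & 0 < i].
Proof.
have gE (i : 'I_n.+2) k : val i = k.+1 -> g i =
    tperm (letter K k false) (letter K i false) * tperm (letter K k true) (letter K i true).
  move=> def_i; rewrite /g /a def_i /b /srefl (_ : _ == _ = false) //.
  by apply/negP=> /eqP[] //.
apply/setP=> s; apply/imset2P/imsetP.
  case=> i j _; rewrite !inE => /= /eqP eq_ji ->; exists j; first by rewrite inE eq_ji.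
  by rewrite (gE j i) // /letter !inord_val.
case=> i; rewrite inE => i0 ->.
have lt_i : i.-1 < n.+2 by have := ltn_ord i; lia.
have def_i : val i = i.-1.+1 by rewrite prednK.
exists (inord i.-1) i => //; first by rewrite !inE /= inordK // -def_i.
by rewrite [LHS](gE _ _ def_i) /letter !inord_val.
Qed.

Lemma gensE_split : S = g 0 |: adjB n.+2.
Proof.
rewrite adjBE; apply/setP=> s; rewrite !inE; apply/imsetP/orP.
  case=> i _ ->; case: (posnP i) => [i0 | i_gt0]; first by left; rewrite i0.
  by right; apply/imsetP; exists i; rewrite ?inE.
by case=> [/eqP-> | /imsetP[i _ ->]]; [exists ord0 | exists i].
Qed.

End SignedModel.

Lemma coxB_model n : exists r g a b root refl,
  @coxeter_model ('I_n.+2 * bool)%type (coxB n.+2) n.+2 r g a b root refl.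
Proof.
suff -> : coxB n.+2 = [set srefl (if val i is k.+1 then letter n.+1 k false
    else letter n.+1 false true) (letter n.+1 i false) | i : 'I_n.+2].
  exact: (signed_model n false).
rewrite (gensE_split n false) /coxB; congr (_ :|: _).
apply/setP=> s; rewrite inE; apply/imsetP/eqP.
  case=> i; rewrite inE => /eqP i0 ->.
  rewrite /srefl /letter /opp /= eqxx mulg1 tpermC.
  by congr (tperm (_, _) (_, _)); apply: val_inj; rewrite /= i0 inordK.
move=> ->; exists (inord 0); first by rewrite inE /= inordK.
by rewrite /srefl /letter /opp /= eqxx mulg1 tpermC.
Qed.

Lemma coxD_model n : exists r g a b root refl,
  @coxeter_model ('I_n.+2 * bool)%type (coxD n.+2) n.+2 r g a b root refl.
Proof.
suff -> : coxD n.+2 = [set srefl (if val i is k.+1 then letter n.+1 k false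
    else letter n.+1 true true) (letter n.+1 i false) | i : 'I_n.+2].
  exact: (signed_model n true).
rewrite (gensE_split n true) /coxD; congr (_ :|: _).
(* The special root of type D is not of the form (x, -x), so [srefl] takes its branch with two
   transpositions. *)
have neq10 : (letter n.+1 0 false == opp (letter n.+1 true true)) = false.
  by apply/negP=> /eqP/(congr1 (@rank n.+1)); rewrite rank_opp !rank_letter //=; lia.
apply/setP=> s; rewrite inE; apply/imset2P/eqP.
  case=> i j _; rewrite !inE /= => /andP[/eqP i0 /eqP j1] ->.
  rewrite /srefl neq10 tpermC (tpermC (i, true)) /letter /opp /=.
  by congr (tperm (_, _) (_, _) * tperm (_, _) (_, _)); apply: val_inj; rewrite /= inordK.
move=> ->; exists (inord 0) (inord 1); rewrite ?inE /= ?inordK //.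
by rewrite /srefl neq10 tpermC (tpermC (opp _)).
Qed.

Theorem theorem3p1 :
  order_n2 (fun n => m4T (coxA n)) /\
  order_n2 (fun n => m4T (coxB n)) /\
  order_n2 (fun n => m4T (coxD n)).
Proof.
split; [|split].
- exact: (order_n2_models coxA_model).
- exact: (order_n2_models coxB_model).
- exact: (order_n2_models coxD_model).
Qed.
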